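(* Let $|\varphi\rangle$ and $|\psi\rangle$ be two $N$-partite pure states in $\mathcal{H}=\mathcal{H}_1\otimes\cdots\otimes\mathcal{H}_N$, $\dim\mathcal{H}_i=d_i$, with coefficient tensors $\mathcal{X}$ and $\mathcal{Y}$ and mode-$i$ matricizations $X_{(i)}$ and $Y_{(i)}$ respectively. Then $|\varphi\rangle$ and $|\psi\rangle$ are SLOCC equivalent if and only if for every $i=1,\dots,N$ there are an invertible $d_i\times d_i$ matrix $P_i$ and an invertible $(d_1\cdots d_{i-1}d_{i+1}\cdots d_N)\times(d_1\cdots d_{i-1}d_{i+1}\cdots d_N)$ matrix $Q_i$ such that $$Y_{(i)}=P_iX_{(i)}Q_i^{\mathrm t}$$ and $$\operatorname{rank}\bigl(R\bigl((Q_i)_{j|\widehat{j}}\bigr)\bigr)=1\qquad\text{for all } j\in\{1,\dots,N\},\ j\neq i.$$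
   Context: Each $\mathcal{H}_t$ is a complex Hilbert space of finite dimension $d_t$ with a fixed orthonormal basis $|1\rangle,\dots,|d_t\rangle$. A pure state is a unit vector $\sum_{j_1,\dots,j_N}\alpha_{j_1\cdots j_N}|j_1\cdots j_N\rangle$ of $\mathcal{H}$, and its coefficient tensor is the array $(\alpha_{j_1\cdots j_N})\in\mathbb{C}^{d_1\times\cdots\times d_N}$. All matrices are complex. Two pure states $|\varphi\rangle,|\psi\rangle$ are SLOCC equivalent if $|\varphi\rangle=(M_1\otimes\cdots\otimes M_N)|\psi\rangle$ for some $M_i\in GL(d_i,\mathbb{C})$. The mode-$n$ matricization $X_{(n)}$ of a tensor $\mathcal{X}=(x_{i_1\cdots i_N})$ of size $d_1\times\cdots\times d_N$ is the $d_n\times\prod_{m\ne n}d_m$ matrix whose $(i_n,j)$ entry is $x_{i_1\cdots i_N}$, where $j=1+\sum_{k\neq n}(i_k-1)\beta_k$ and $\beta_k=\prod_{m<k,\ m\neq n}d_m$. $\mathrm t$ denotes transpose (without conjugation). Realignment: for a matrix $Y$, $\mathrm{vec}(Y)$ is the column vector obtained by stacking the columns of $Y$. For an $m\times m$ block matrix $Z=(Z_{pq})$ with blocks $Z_{pq}$ of size $n\times n$, $R(Z)=[\mathrm{vec}(Z_{11}),\dots,\mathrm{vec}(Z_{m1}),\dots,\mathrm{vec}(Z_{1m}),\dots,\mathrm{vec}(Z_{mm})]^{\mathrm t}$, an $m^2\times n^2$ matrix. Bipartite partition: rows and columns of $Q_i$ are indexed by multi-indices $(k_l)_{l\neq i}$,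 $1\le k_l\le d_l$, listed in the same order as the columns of $X_{(i)}$ (so that $M_N\otimes\cdots\otimes M_{i+1}\otimes M_{i-1}\otimes\cdots\otimes M_1$ is such a matrix with $M_l$ acting on the index $k_l$). For $j\ne i$, $(Q_i)_{j|\widehat j}$ is $Q_i$ regarded as a $d_j\times d_j$ block matrix whose $(p,q)$ block consists of the entries with row index $k_j=p$ and column index $k_j=q$, the rows and columns inside the block being indexed by the remaining indices $(k_l)_{l\neq i,j}$ in a fixed common order. *)

(* Defs.v *)
From HB Require Import structures.
From mathcomp Require Import all_boot all_order all_algebra.

Set Implicit Arguments.
Unset Strict Implicit.
Unset Printing Implicit Defensive.

Import Order.TTheory GRing.Theory Num.Theory.
Local Open Scope ring_scope.

(* Modes, indices and positions are numbered from 0. *)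
Notation multi_index d := {dffun forall k, 'I_(d k)}.

Section Positions.
Variables (N : nat) (d : 'I_N -> nat).
Implicit Types (S : {set 'I_N}) (f : 'I_N -> nat).
Local Open Scope nat_scope.

Definition dim_of S : nat := \prod_(l in S) d l.

Definition stride S (k : 'I_N) : nat := \prod_(m in S | m < k) d m.

(* 0-based version of 1 + \sum_(k in S) (i_k - 1) * stride S k. *)
Definition position S f : nat := \sum_(k in S) f k * stride S k.

(* The l-th component of the multi-index over S found at position c. *)
Definition digit S (c : nat) (l : 'I_N) : nat := c %/ stride S l %% d l.

Local Definition below S n := \prod_(m in S | m < n) d m.
Local Definition psum S f n := \sum_(k in S | k < n) f k * stride S k.

Lemma big_below (T : Type) (idx : T) (op : Monoid.com_law idx) S
    (F : 'I_N -> T) (k : 'I_N) :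
  \big[op/idx]_(m in S | m < k.+1) F m =
  op (if k \in S then F k else idx) (\big[op/idx]_(m in S | m < k) F m).
Proof.
case: ifP => kS.
  rewrite (bigD1 k) /= ?kS ?ltnSn //; congr (op _ _).
  apply: eq_bigl => m; rewrite -andbA; congr (_ && _).
  by rewrite ltnS [RHS]ltn_neqAle andbC.
rewrite Monoid.mul1m; apply: eq_bigl => m.
rewrite ltnS leq_eqVlt; case: eqP => [/val_inj->|//].
by rewrite kS.
Qed.

Lemma position_lt S f : (forall l, l \in S -> f l < d l) ->
  position S f < dim_of S.
Proof.
move=> fd.
have H n : n <= N -> psum S f n < below S n.
  elim: n => [|n IHn] nN; first by rewrite /psum /below !big_pred0 // => i; rewrite andbF.
  pose k := Ordinal nN; have := IHn (ltnW nN).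
  rewrite /psum /below (big_below _ _ _ k) (big_below _ _ _ k) /=.
  rewrite -/(below S n) -/(psum S f n) -[stride S k]/(below S n).
  case: ifP => [kS|_]; last by rewrite add0n mul1n.
  move=> lt; apply: (@leq_trans ((f k).+1 * below S n)).
    by rewrite mulSn addnC ltn_add2r.
  by rewrite leq_mul2r fd // orbT.
have := H N (leqnn N).
rewrite /psum /below /position /dim_of.
by under eq_bigl do rewrite ltn_ord andbT; under [X in _ < X]eq_bigl do rewrite ltn_ord andbT.
Qed.

Lemma digit_position S f l : (forall m, m \in S -> f m < d m) -> l \in S ->
  digit S (position S f) l = f l.
Proof.
move=> fd lS.
have B0 : 0 < stride S l.
  by apply: prodn_cond_gt0 => m /andP[mS _]; apply: leq_ltn_trans (fd m mS).
have low : psum S f l < stride S l.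
  pose S' := [set m in S | m < l].
  have st (k : 'I_N) : k < l -> stride S' k = stride S k.
    move=> kl; apply: eq_bigl => m; rewrite inE -andbA; congr (_ && _).
    by case: (ltnP m k) => [/ltn_trans->|]; rewrite ?andbF.
  have -> : psum S f l = position S' f.
    rewrite /position /psum; apply: eq_big => [k|k /andP[_ kl]]; first by rewrite inE.
    by rewrite st.
  have -> : stride S l = dim_of S' by apply: eq_bigl => m; rewrite inE.
  by apply: position_lt => m; rewrite inE => /andP[/fd].
have H n : l < n -> n <= N ->
    (exists q, psum S f n = psum S f l + f l * stride S l + q * (stride S l * d l)) /\
    (exists q, below S n = q * (stride S l * d l)).
  elim: n => // n IHn; rewrite ltnS leq_eqVlt => /predU1P[<- _|ln nN].
    rewrite /psum /below !big_below lS; split; first by exists 0; rewrite mul0n addn0 addnC.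
    by exists 1; rewrite mul1n mulnC.
  have [[q pq] [r br]] := IHn ln (ltnW nN); pose k := Ordinal nN.
  rewrite /psum /below !(big_below _ _ _ k) /= -/(below S n) -/(psum S f n).
  rewrite -[stride S k]/(below S n) pq br.
  case: ifP => _; split.
  - by exists (f k * r + q); rewrite mulnDl -mulnA addnC -!addnA [q * _ + _]addnC.
  - by exists (d k * r); rewrite mulnA.
  - by exists q.
  - by exists r; rewrite mul1n.
have [[q pq] _] := H N (ltn_ord l) (leqnn N).
have -> : position S f = psum S f N by apply: eq_bigl => k; rewrite ltn_ord andbT.
rewrite /digit pq.
have -> : psum S f l + f l * stride S l + q * (stride S l * d l) =
  (q * d l + f l) * stride S l + psum S f l.
  by rewrite mulnDl -mulnA [d l * _]mulnC addnC [psum _ _ _ + _]addnC addnA.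
by rewrite divnMDl // (divn_small low) addn0 modnMDl modn_small // fd.
Qed.

Lemma digit_lt S (c : 'I_(dim_of S)) l : l \in S -> digit S c l < d l.
Proof.
move=> lS; apply: ltn_pmod; case: c => c; rewrite /dim_of (bigD1 l) //=.
by case: (d l) => //; rewrite mul0n.
Qed.

Lemma position_digit S (c : 'I_(dim_of S)) : position S (digit S c) = c.
Proof.
have H n : n <= N -> psum S (digit S c) n = c %% below S n.
  elim: n => [|n IHn] nN.
    by rewrite /psum /below !big_pred0 ?modn1 // => i; rewrite andbF.
  pose k := Ordinal nN; have := IHn (ltnW nN).
  rewrite /psum /below !(big_below _ _ _ k) /= -/(below S n) -/(psum _ _ n) => ->.
  case: ifP => [kS|_]; last by rewrite add0n mul1n.
  rewrite /digit -[stride S k]/(below S n) modn_divl.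
  have /modn_dvdm <- : below S n %| d k * below S n by apply: dvdn_mull.
  by rewrite -divn_eq.
have := H N (leqnn N).
rewrite /psum /below /position /dim_of.
under eq_bigl do rewrite ltn_ord andbT; under [X in _ = _ %% X]eq_bigl do rewrite ltn_ord andbT.
by move=> ->; rewrite modn_small.
Qed.

Definition pos S (k : multi_index d) : 'I_(dim_of S) :=
  Ordinal (@position_lt S (fun l => k l) (fun l _ => ltn_ord (k l))).

Lemma insert_subproof S (j : 'I_N) (p : 'I_(d j)) (r : 'I_(dim_of (S :\ j))) l :
  l \in S -> (if l == j then p : nat else digit (S :\ j) r l) < d l.
Proof.
case: eqP => [-> //|/eqP lj] lS; apply: digit_lt; by rewrite !inE lj.
Qed.

(* The position, over S, of the multi-index with j-th component p whose other
   components form the multi-index at position r over S :\ j. *)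
Definition insert S (j : 'I_N) (p : 'I_(d j)) (r : 'I_(dim_of (S :\ j))) :
    'I_(dim_of S) :=
  Ordinal (position_lt (insert_subproof p r)).

Lemma insert_pos S j (k : multi_index d) :
  insert (k j) (pos (S :\ j) k) = pos S k.
Proof.
apply: val_inj => /=; apply: eq_bigr => l lS; congr (_ * _).
case: eqP => [-> //|/eqP lj]; rewrite digit_position //.
by rewrite !inE lj.
Qed.

End Positions.

Section Tensors.
Variables (C : numClosedFieldType) (N : nat) (d : 'I_N -> nat).

(* A vector of H is given by its coefficient tensor in the product basis. *)
Definition tensor := {ffun multi_index d -> C}.

Definition pure_state (x : tensor) : Prop := \sum_k `|x k| ^+ 2 = 1.

(* The action of the tensor product M_1 (x) ... (x) M_N on coefficients. *)
Definition tensor_map (M : forall t, 'M[C]_(d t)) (x : tensor) : tensor :=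
  [ffun j : multi_index d => \sum_(k : multi_index d) (\prod_t M t (j t) (k t)) * x k].

Definition slocc_equivalent (phi psi : tensor) : Prop :=
  exists M : forall t, 'M[C]_(d t),
    (forall t, M t \in unitmx) /\ phi = tensor_map M psi.

(* Exactly one multi-index k has n-th component a and other components at
   position c, so the sum has a single term. *)
Definition matricization (n : 'I_N) (x : tensor) :
    'M[C]_(d n, dim_of d [set~ n]) :=
  \matrix_(a, c) \sum_(k : multi_index d | (k n == a) && (pos [set~ n] k == c)) x k.

Lemma matricizationE n x (k : multi_index d) :
  matricization n x (k n) (pos [set~ n] k) = x k.
Proof.
rewrite mxE (bigD1 k) ?eqxx //= big1 ?addr0 // => k' /andP[/andP[/eqP kn /eqP pk]].
case/eqP; apply/ffunP => l; have [-> //|ln] := eqVneq l n.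
apply: val_inj; have lS : l \in [set~ n] by rewrite !inE.
move: (congr1 (fun c : 'I__ => digit d [set~ n] c l) pk) => /=.
by rewrite !digit_position.
Qed.

(* Q_{j|^j} for Q indexed by the multi-indices over S. *)
Definition bipartition (S : {set 'I_N}) (j : 'I_N) (Q : 'M[C]_(dim_of d S)) :
    'M['M[C]_(dim_of d (S :\ j))]_(d j) :=
  \matrix_(p, q) \matrix_(r, s) Q (insert p r) (insert q s).

Lemma bipartitionE S j Q (k k' : multi_index d) :
  @bipartition S j Q (k j) (k' j) (pos (S :\ j) k) (pos (S :\ j) k') =
  Q (pos S k) (pos S k').
Proof. by rewrite !mxE !insert_pos. Qed.

End Tensors.

Section Realignment.

(* mxvec lists the entries row by row, whence the transpose. *)
Definition vec (T : Type) m n (Y : 'M[T]_(m, n)) : 'cV[T]_(n * m) :=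
  (mxvec Y^T)^T.

(* A block matrix is a matrix of matrices; the order Z_11, ..., Z_m1, ...,
   Z_1m, ..., Z_mm of the blocks is that of the outer vec. *)
Definition realign (T : Type) m n (Z : 'M['M[T]_n]_m) : 'M[T]_(m * m, n * n) :=
  \matrix_(a, b) vec (\matrix_(p, q) vec (Z p q)) a 0 b 0.

Lemma realignE (T : Type) m n (Z : 'M['M[T]_n]_m) p q r s :
  realign Z (mxvec_index q p) (mxvec_index s r) = Z p q r s.
Proof. by rewrite mxE /vec mxE mxvecE !mxE mxvecE mxE. Qed.

End Realignment.

(* Main.v *)
(* Matricization turns the action of M_1 (x) ... (x) M_N into
   X_(i) |-> M_i X_(i) K^T, where K is the tensor product of the M_l, l != i,
   so one direction takes Q_i = K.  Conversely, a single i suffices: rank one of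
   R(Q_{j|^j}) makes the 2x2 minors vanish, so the j-th components of two pairs
   (row, column) of multi-indices can be exchanged without changing the product
   of the two entries of Q.  Exchanging the components one at a time with those
   of a fixed nonzero entry c of Q writes Q as c times a tensor product, whose
   factors are invertible because Q is. *)
Require Import Defs.
From mathcomp Require Import all_boot all_order all_algebra.
From mathcomp Require Import reals complex.
Set Implicit Arguments.
Unset Strict Implicit.
Unset Printing Implicit Defensive.
Import Order.TTheory GRing.Theory Num.Theory.
Local Open Scope ring_scope.

(** Passing to [fprod] and then to tagged elements puts all the index types into a single one, where
    the usual distributivity [bigA_distr_big_dep] applies. *)
Lemma prod_sum_dffun (R : comPzSemiRingType) (I : finType) (T : I -> finType)
    (F : forall t, T t -> R) :
  \prod_t \sum_s F t s = \sum_(k : {dffun forall t, T t}) \prod_t F t (k t).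
Proof.
rewrite (reindex _ (onW_bij _ (dffun_of_fprod_bij T))) /=.
pose f t := [ffun s => F t s].
transitivity (\sum_(k : fprod T) \prod_(t in I) f t (k t)); last first.
  by apply: eq_bigr => k _; apply: eq_bigr => t _; rewrite !ffunE.
rewrite big_fprod.
transitivity (\prod_t \sum_(u in tagged_with T t) untag 0 (f t) u).
  apply: eq_bigr => t _; rewrite -[RHS](big_tag (op := +%R) (fun t => f t)).
  by apply: eq_bigr => s _; rewrite ffunE.
exact: bigA_distr_big_dep.
Qed.

(** * Decoding positions into multi-indices *)

Section Positions.
Variables (N : nat) (d : 'I_N -> nat).
Implicit Types (S : {set 'I_N}) (k : multi_index d).

Definition set_at k j (p : 'I_(d j)) : multi_index d := [ffun l => dfwith k p l].

Lemma set_at_in k j p : @set_at k j p j = p.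
Proof. by rewrite ffunE dfwith_in. Qed.

Lemma set_at_out k j p l : l != j -> @set_at k j p l = k l.
Proof. by move=> lj; rewrite ffunE dfwith_out // eq_sym. Qed.

(* A position over S leaves the components outside S free; k provides them. *)
Definition unpos k S (c : 'I_(dim_of d S)) : multi_index d :=
  [ffun l => insubd (k l) (digit d S c l)].

Lemma pos_eqP S k k' : (forall l, l \in S -> k l = k' l) <-> pos S k = pos S k'.
Proof.
split=> [kk'|pkk' l lS].
  by apply: val_inj; apply: eq_bigr => l lS; rewrite kk'.
apply: val_inj; move: (congr1 (fun c : 'I__ => digit d S c l) pkk') => /=.
by rewrite !digit_position.
Qed.

Lemma unposK k S : cancel (unpos k (S := S)) (pos S).
Proof.
move=> c; apply: val_inj; rewrite -[RHS]position_digit /=.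
apply: eq_bigr => l lS; congr (_ * _)%N.
by rewrite ffunE insubdK //; apply: digit_lt.
Qed.

Lemma unpos_pos k S k' l : l \in S -> unpos k (pos S k') l = k' l.
Proof. by move: l; apply/pos_eqP; rewrite unposK. Qed.

(** A multi-index amounts to its [i]-th component together with the position of the others; [k0]
    serves only to write down the inverse bijection. *)
Lemma sum_positions (V : nmodType) i (F : 'I_(d i) -> 'I_(dim_of d [set~ i]) -> V) k0 :
  \sum_(k : multi_index d) F (k i) (pos [set~ i] k) = \sum_b \sum_c F b c.
Proof.
rewrite pair_bigA /=.
rewrite (reindex (fun u : 'I_(d i) * 'I_(dim_of d [set~ i]) => set_at (unpos k0 u.2) u.1)) /=.
  apply: eq_bigr => -[b c] _ /=; rewrite set_at_in; congr (F _ _).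
  rewrite -[RHS](unposK k0); apply/pos_eqP => l; rewrite !inE => li.
  by rewrite set_at_out.
exists (fun k => (k i, pos [set~ i] k)) => [[b c] _|k _] /=.
  rewrite set_at_in; congr (_, _).
  rewrite -[RHS](unposK k0); apply/pos_eqP => l; rewrite !inE => li.
  by rewrite set_at_out.
apply/ffunP => l; have [->|li] := eqVneq l i; first by rewrite set_at_in.
by rewrite set_at_out // unpos_pos // !inE.
Qed.

End Positions.

(** * Tensor products of matrices and their action on tensors *)

Section Kronecker.
Variables (C : numClosedFieldType) (N : nat) (d : 'I_N -> nat).
Variable k0 : multi_index d.
Implicit Types (S : {set 'I_N}) (k : multi_index d).
Implicit Types (M L : forall t, 'M[C]_(d t)) (x : tensor C d).

(** The entries do not depend on [k0]: only components in [S] are read, and the positions determine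
    those. *)
Definition kron S M : 'M[C]_(dim_of d S) :=
  \matrix_(c, c') \prod_(l in S) M l (unpos k0 c l) (unpos k0 c' l).

Lemma kronE S M k k' :
  kron S M (pos S k) (pos S k') = \prod_(l in S) M l (k l) (k' l).
Proof. by rewrite mxE; apply: eq_bigr => l lS; rewrite !unpos_pos. Qed.

Lemma positions_matrixP S (A B : 'M[C]_(dim_of d S)) :
  (forall k k', A (pos S k) (pos S k') = B (pos S k) (pos S k')) -> A = B.
Proof.
by move=> AB; apply/matrixP => c c'; rewrite -[c](unposK k0) -[c'](unposK k0).
Qed.

(** To apply distributivity over full multi-indices, the inner sum over positions gets a dummy
    [i]-th component, pinned to [k0 i] by a Kronecker delta. *)
Lemma kron_mul i M L :
  kron [set~ i] M *m kron [set~ i] L = kron [set~ i] (fun t => M t *m L t).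
Proof.
apply: positions_matrixP => k k'; rewrite mxE kronE.
pose G t (s : 'I_(d t)) : C :=
  if t == i then (s == k0 t)%:R else M t (k t) s * L t s (k' t).
pose H b c : C := (b == k0 i)%:R *
  (kron [set~ i] M (pos _ k) c * kron [set~ i] L c (pos _ k')).
transitivity (\sum_b \sum_c H b c).
  by rewrite (bigD1 (k0 i)) //= [X in _ + X]big1 ?addr0 => [|b /negPf bi];
    [|by apply: big1 => c _; rewrite /H bi mul0r];
    apply: eq_bigr => c _; rewrite /H eqxx mul1r.
rewrite -(sum_positions _ k0).
transitivity (\prod_t \sum_s G t s).
  rewrite prod_sum_dffun; apply: eq_bigr => m _; rewrite /H !kronE.
  rewrite [RHS](bigD1 i) //= {1}/G eqxx -big_split /=; congr (_ * _).
  by apply: eq_big => [t|t]; rewrite !inE // => /negPf ti; rewrite /G ti.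
rewrite (bigD1 i) //= {1}/G eqxx (bigD1 (k0 i)) //= eqxx big1 => [|s /negPf->//].
rewrite addr0 mul1r; apply: eq_big => [t|t /negPf ti]; first by rewrite !inE.
by rewrite mxE; apply: eq_bigr => s _; rewrite /G ti.
Qed.

Lemma eq_kron S M L : (forall t, t \in S -> M t = L t) -> kron S M = kron S L.
Proof.
by move=> ML; apply/matrixP => c c'; rewrite !mxE; apply: eq_bigr => l /ML ->.
Qed.

Lemma kron1 S : kron S (fun=> 1%:M) = 1%:M.
Proof.
apply: positions_matrixP => k k'; rewrite kronE mxE; case: eqP => [/pos_eqP kk'|kk'].
  by apply: big1 => l lS; rewrite mxE kk' ?eqxx.
have [l /andP[lS klk']|keq] := pickP [pred l in S | k l != k' l]; last first.
  case: kk'; apply/pos_eqP => l lS.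
  by move: (keq l); rewrite /= lS => /negPn/eqP.
by rewrite (bigD1 l) //= mxE (negPf klk') mul0r.
Qed.

Lemma kron_unit i M : (forall t, M t \in unitmx) -> kron [set~ i] M \in unitmx.
Proof.
move=> Mu; have [] // := @mulmx1_unit _ _ (kron [set~ i] M)
  (kron [set~ i] (fun t => invmx (M t))).
by rewrite kron_mul -(kron1 [set~ i]); apply: eq_kron => t _; rewrite mulmxV.
Qed.

(** In the product of [kron S M] with its inverse [B], keep the rows and columns that agree with
    [k0] off [j]. Grouping the inner sum by its [j]-th component [s] pulls out [M j p s], and what
    is left is a right inverse [X] of [M j]. *)
Lemma unit_kron S M j : kron S M \in unitmx -> j \in S -> M j \in unitmx.
Proof.
move=> Ku jS; pose B := invmx (kron S M).
pose X : 'M_(d j) := \matrix_(s, q) \sum_(c | unpos k0 c j == s)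
  (\prod_(l in S | l != j) M l (k0 l) (unpos k0 c l)) * B c (pos S (set_at k0 q)).
have [] // := @mulmx1_unit _ _ (M j) X; apply/matrixP => p q.
transitivity ((kron S M *m B) (pos S (set_at k0 p)) (pos S (set_at k0 q))); last first.
  rewrite mulmxV // !mxE; congr (_%:R); congr nat_of_bool; apply/eqP/eqP => [|-> //].
  by move/pos_eqP/(_ j jS); rewrite !set_at_in.
rewrite !mxE (partition_big (fun c => unpos k0 c j) xpredT) //=.
apply: eq_bigr => s _; rewrite mxE big_distrr /=; apply: eq_bigr => c /eqP cs.
rewrite mulrA; congr (_ * _); rewrite mxE [RHS](bigD1 j) //= unpos_pos // set_at_in cs.
congr (_ * _); apply: eq_bigr => l /andP[lS lj].
by rewrite unpos_pos // set_at_out.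
Qed.

Lemma tensor_map_comp M L x :
  tensor_map M (tensor_map L x) = tensor_map (fun t => M t *m L t) x.
Proof.
apply/ffunP => j; rewrite !ffunE.
under eq_bigr do rewrite ffunE big_distrr /=.
rewrite exchange_big /=; apply: eq_bigr => k _.
under eq_bigr do rewrite mulrA -big_split /=.
rewrite -big_distrl /=; congr (_ * _).
rewrite -(prod_sum_dffun (fun t s => M t (j t) s * L t s (k t))).
by apply: eq_bigr => t _; rewrite mxE.
Qed.

Lemma tensor_map1 x : tensor_map (fun=> 1%:M) x = x.
Proof.
apply/ffunP => j; rewrite ffunE (bigD1 j) //= [X in _ + X]big1 => [|k kj].
  by rewrite addr0 big1 ?mul1r // => t _; rewrite mxE eqxx.
have [t tjk|jk] := pickP [pred t | j t != k t]; last first.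
  by case/eqP: kj; apply/ffunP => t; move/(_ t)/negPn/eqP: jk.
by rewrite (bigD1 t) //= mxE (negPf tjk) !mul0r.
Qed.

Lemma matricization_tensor_map i M x :
  matricization i (tensor_map M x) =
  M i *m matricization i x *m (kron [set~ i] M)^T.
Proof.
apply/matrixP => a c.
have [k [-> ->]] : exists k, a = k i /\ c = pos [set~ i] k.
  exists (set_at (unpos k0 c) a); rewrite set_at_in -{1}[c](unposK k0).
  by split=> //; apply/pos_eqP => l; rewrite !inE => li; rewrite set_at_out.
rewrite matricizationE ffunE -mulmxA mxE.
under [RHS]eq_bigr do rewrite mxE big_distrr /=.
rewrite -(sum_positions _ k0); apply: eq_bigr => m _.
rewrite matricizationE mxE kronE (bigD1 i) //= -mulrA [x m * _]mulrC.
by congr (_ * (_ * _)); apply: eq_bigl => l; rewrite !inE.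
Qed.

Lemma matricization_inj i : injective (@matricization C N d i).
Proof. by move=> x y xy; apply/ffunP => k; rewrite -!(matricizationE i) xy. Qed.

Lemma slocc_equivalent_sym x y : slocc_equivalent x y -> slocc_equivalent y x.
Proof.
case=> M [Mu ->]; exists (fun t => invmx (M t)).
split=> [t|]; first by rewrite unitmx_inv.
rewrite tensor_map_comp -[LHS]tensor_map1; apply/ffunP => j; rewrite !ffunE.
by apply: eq_bigr => k _; congr (_ * _); apply: eq_bigr => t _; rewrite mulVmx.
Qed.

End Kronecker.

(** * Matrices of rank one *)

Section RankOne.
Variables (F : fieldType) (m n : nat).

Lemma rank1_minor (W : 'M[F]_(m, n)) : \rank W = 1%N ->
  forall a a' b b', W a b * W a' b' = W a b' * W a' b.
Proof.
move=> rW a a' b b'; rewrite -(mulmx_base W).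
move: (col_base W) (row_base W); rewrite rW => U V.
by rewrite !mxE !big_ord1 mulrACA [X in _ * X]mulrC mulrACA.
Qed.

Lemma rank_col_row (u : 'cV[F]_m) (v : 'rV[F]_n) :
  u *m v != 0 -> \rank (u *m v) = 1%N.
Proof.
move=> uv0; apply/eqP; rewrite eqn_leq lt0n mxrank_eq0 uv0 andbT.
exact: leq_trans (mxrankM_maxr _ _) (rank_leq_row _).
Qed.

End RankOne.

(** * Realignment and factorization into a tensor product *)

Section Realign.
Variables (C : numClosedFieldType) (N : nat) (d : 'I_N -> nat).
Variable k0 : multi_index d.
Implicit Types (S : {set 'I_N}) (k : multi_index d).

Lemma bipartition_set_at S j (Q : 'M[C]_(dim_of d S)) k k' p q :
  bipartition j Q p q (pos (S :\ j) k) (pos (S :\ j) k') =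
  Q (pos S (set_at k p)) (pos S (set_at k' q)).
Proof.
rewrite -(bipartitionE j Q) !set_at_in; congr (bipartition j Q p q _ _);
  by apply/pos_eqP => l; rewrite !inE => /andP[lj _]; rewrite set_at_out.
Qed.

(** Realignment separates the [j]-th factor from the others, giving the column [vec (M j)] times a
    row. This product is nonzero, since otherwise the invertible matrix would vanish although it has
    an entry at [k0]. *)
Lemma rank_realign_kron S j (M : forall t, 'M[C]_(d t)) : j \in S ->
  kron k0 S M \in unitmx -> \rank (realign (bipartition j (kron k0 S M))) = 1%N.
Proof.
move=> jS Ku.
pose u : 'cV[C]_(d j * d j) := vec (M j).
pose v := (vec (kron k0 (S :\ j) M))^T.
have Wuv : realign (bipartition j (kron k0 S M)) = u *m v.
  apply/matrixP => a b; case/mxvec_indexP: a => q p; case/mxvec_indexP: b => s r.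
  rewrite realignE [RHS]mxE big_ord1 /u /v /vec trmxK [X in _ = X * _]mxE !mxvecE.
  rewrite [X in _ = X * _]mxE [X in _ = _ * X]mxE.
  rewrite -[r](unposK k0) -[s](unposK k0) bipartition_set_at !kronE.
  rewrite (bigD1 j) //= !set_at_in; congr (_ * _).
  apply: eq_big => [l|l /andP[lS lj]]; first by rewrite !inE andbC.
  by rewrite !set_at_out.
rewrite Wuv rank_col_row // -Wuv; apply/eqP => W0.
suff K0 : kron k0 S M = 0.
  move: (mulmxV Ku); rewrite K0 mul0mx => /matrixP /(_ (pos S k0) (pos S k0)) /eqP.
  by rewrite !mxE eqxx eq_sym oner_eq0.
apply: (positions_matrixP k0) => k k'.
by rewrite -(bipartitionE j (kron _ _ _)) -realignE W0 !mxE.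
Qed.

Section Product.
Variables (S : {set 'I_N}) (Q : 'M[C]_(dim_of d S)).
Hypothesis rkQ : forall j, j \in S -> \rank (realign (bipartition j Q)) = 1%N.

Lemma exchange_component j k k' m m' : j \in S ->
  Q (pos S k) (pos S k') * Q (pos S m) (pos S m') =
  Q (pos S (set_at k (m j))) (pos S (set_at k' (m' j))) *
  Q (pos S (set_at m (k j))) (pos S (set_at m' (k' j))).
Proof.
move=> jS; rewrite -!(bipartition_set_at Q) -!(bipartitionE j Q) -!realignE.
by rewrite (rank1_minor (rkQ jS)) mulrC.
Qed.

Lemma kron_of_rank1 k0' : Q (pos S k0) (pos S k0') != 0 ->
  exists M, Q = Q (pos S k0) (pos S k0') *: kron k0 S M.
Proof.
set c := Q _ _ => c0.
(* Entries of [Q] at the base pair [(k0, k0')] with only the [t]-th components changed, normalized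
   so that the base entry becomes 1. *)
pose M t := \matrix_(p < d t, q < d t)
  (Q (pos S (set_at k0 p)) (pos S (set_at k0' q)) / c).
exists M; pose mix (s : seq 'I_N) k1 k : multi_index d :=
  [ffun l => if l \in s then k l else k1 l].
have mixQ s k k' : uniq s -> {subset s <= S} ->
    Q (pos S (mix s k0 k)) (pos S (mix s k0' k')) =
    c * \prod_(l <- s) M l (k l) (k' l).
  elim: s => [_ _|j s IHs /= /andP[js us] sS].
    by rewrite big_nil mulr1; congr (Q _ _); apply/pos_eqP => l _; rewrite ffunE.
  have jS : j \in S by apply: sS; rewrite mem_head.
  have mix_cons k1 k2 : set_at (mix (j :: s) k1 k2) (k1 j) = mix s k1 k2.
    apply/ffunP => l; have [->|lj] := eqVneq l j.
      by rewrite set_at_in ffunE (negPf js).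
    by rewrite set_at_out // !ffunE inE (negPf lj).
  (* The extra factor [c] is the base entry with which the [j]-th components are exchanged: one
     entry falls back to [mix s], the other becomes [c * M j (k j) (k' j)]. *)
  apply: (mulIf c0); rewrite {1}/c (exchange_component _ _ _ _ jS) !mix_cons.
  rewrite IHs // => [|l ls]; last by rewrite sS // inE ls orbT.
  rewrite big_cons !ffunE !mem_head [M j _ _]mxE.
  by rewrite -!mulrA [_ * c]mulrC mulKf // [X in _ = _ * X]mulrC.
apply: (positions_matrixP k0) => k k'; rewrite mxE kronE -big_enum /=.
rewrite -mixQ ?enum_uniq // => [|l]; last by rewrite mem_enum.
by congr (Q _ _); apply/pos_eqP => l lS; rewrite ffunE mem_enum lS.
Qed.

End Product.

Lemma unit_rank1_kron S (Q : 'M[C]_(dim_of d S)) : Q \in unitmx ->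
  (forall j, j \in S -> \rank (realign (bipartition j Q)) = 1%N) ->
  exists2 c, c != 0 &
    exists2 M, (forall j, j \in S -> M j \in unitmx) & Q = c *: kron k0 S M.
Proof.
move=> Qu rkQ.
(* An invertible matrix has no zero row, so the row of [k0] provides a nonzero base entry. *)
have [c' Qc'|Q0] := pickP (fun c' => Q (pos S k0) c' != 0); last first.
  move: (mulmxV Qu) => /matrixP /(_ (pos S k0) (pos S k0)) /eqP.
  rewrite !mxE eqxx big1 1?eq_sym ?oner_eq0 // => c' _.
  by move/negPn/eqP: (Q0 c') => ->; rewrite mul0r.
rewrite -[c'](unposK k0) in Qc'.
have [M QM] := kron_of_rank1 rkQ Qc'.
exists (Q (pos S k0) (pos S (unpos k0 c'))) => //; exists M => // j.
apply: (unit_kron (k0 := k0)); move: Qu; rewrite QM.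
by rewrite unitmxZ ?unitfE // -QM.
Qed.

End Realign.

Theorem theorem3 (R : realType) (N : nat) (hN : (0 < N)%N) (d : 'I_N -> nat)
    (phi psi : tensor R[i] d) (hphi : pure_state phi) (hpsi : pure_state psi) :
  slocc_equivalent phi psi <->
  forall i : 'I_N,
    exists (P : 'M[R[i]]_(d i)) (Q : 'M[R[i]]_(dim_of d [set~ i])),
      [/\ P \in unitmx, Q \in unitmx,
          matricization i psi = P *m matricization i phi *m Q^T &
          forall j : 'I_N, j != i -> \rank (realign (bipartition j Q)) = 1%N].
Proof.
(* A tensor of norm one has at least one entry; this supplies the default multi-index [k0]. *)
have [k0 _|no_index] := pickP (fun _ : multi_index d => true); last first.
  by move: hphi; rewrite /pure_state big_pred0 // => /eqP; rewrite eq_sym oner_eq0.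
(* Symmetry is needed because equivalence expresses [phi] through [psi], whereas the matrix equation
   expresses [psi] through [phi]. *)
split=> [/slocc_equivalent_sym[M [Mu ->]] i|PQ].
  have Ku := kron_unit k0 i Mu.
  exists (M i), (kron k0 [set~ i] M); split=> // [|j ji].
    exact: matricization_tensor_map.
  by apply: rank_realign_kron => //; rewrite !inE.
pose i := Ordinal hN; have [P [Q [Pu Qu psiE rkQ]]] := PQ i.
have [|c c0 [A Au QA]] := unit_rank1_kron k0 Qu.
  by move=> j; rewrite !inE => /rkQ.
(* The scalar [c] is absorbed into the factor at mode [i], which stays invertible as [c] is
   nonzero. *)
apply: slocc_equivalent_sym; exists (fun t => dfwith A (c *: P) t); split=> [t|].
  have [->|ti] := eqVneq t i; first by rewrite dfwith_in unitmxZ ?unitfE.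
  by rewrite dfwith_out 1?eq_sym // Au // !inE.
apply: (@matricization_inj _ _ _ i); rewrite psiE (matricization_tensor_map k0).
rewrite dfwith_in QA linearZ /= -!scalemxAl -scalemxAr; congr (_ *: (_ *m _^T)).
by apply: eq_kron => t; rewrite !inE => ti; rewrite dfwith_out 1?eq_sym.
Qed.
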